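(* Let $\beta\in(0,1]$, let $\mathfrak{g}(x)=x^\beta$ and $\mathfrak{h}(x)=\frac{1}{\log(1/x)}$ (for small $x>0$, with $\mathfrak h(0)=0$). If $E\subseteq\mathbb{R}^2$ is an $F_{\mathfrak{h}\mathfrak{g}}$-set, then $\dim(E)\ge\frac{\beta}{2}$.
   Context: $\dim$ denotes Hausdorff dimension. For a non-decreasing $h$ with $h(0)=0$, $F\subseteq\mathbb{R}^n$, $\delta>0$: $\mathcal{H}^h_\delta(F)=\inf\{\sum_i h(\mathrm{diam}(F_i)): F\subseteq\bigcup_i F_i,\ \mathrm{diam}(F_i)<\delta\}$ and $\mathcal{H}^h(F)=\sup_{\delta>0}\mathcal{H}^h_\delta(F)$. $\mathbb{S}$ is the unit circle. A set $E\subseteq\mathbb{R}^2$ is an $F_{\mathfrak{h}\mathfrak{g}}$-set if there is $L\subseteq\mathbb{S}$ with $\mathcal{H}^{\mathfrak{g}}(L)>0$ and a number $\delta_E>0$ such that for each $e\in L$ there is a line segment $\ell_e$ in direction $e$ with $\mathcal{H}^{\mathfrak{h}}_\delta(\ell_e\cap E)>1$ for all $0<\delta<\delta_E$. *)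

(* Defs.v *)
From Stdlib Require Import Reals.
Open Scope R_scope.

Definition R2 : Type := (R * R)%type.

Definition dist2 (p q : R2) : R :=
  sqrt ((fst p - fst q) ^ 2 + (snd p - snd q) ^ 2).

(* d is the diameter of A (sup of pairwise distances; diam of the empty set is 0).
   Requiring d to exist makes A bounded. *)
Definition is_diam (A : R2 -> Prop) (d : R) : Prop :=
  0 <= d /\
  (forall x y, A x -> A y -> dist2 x y <= d) /\
  (forall d', 0 <= d' -> (forall x y, A x -> A y -> dist2 x y <= d') -> d <= d').

Definition delta_cover_sum (h : R -> R) (delta : R) (F : R2 -> Prop) (s : R) : Prop :=
  exists (A : nat -> R2 -> Prop) (d : nat -> R),
    (forall i, is_diam (A i) (d i) /\ d i < delta) /\
    (forall x, F x -> exists i, A i x) /\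
    Un_cv (fun N => sum_f_R0 (fun i => h (d i)) N) s.

(* H^h_delta(F) > t  (infimum over covers; divergent sums count as +infinity). *)
Definition Hcontent_gt (h : R -> R) (delta : R) (F : R2 -> Prop) (t : R) : Prop :=
  exists c, t < c /\ forall s, delta_cover_sum h delta F s -> c <= s.

(* H^h(F) = 0, i.e. H^h_delta(F) = 0 for every delta > 0 (h >= 0). *)
Definition Hnull (h : R -> R) (F : R2 -> Prop) : Prop :=
  forall delta, 0 < delta -> forall eps, 0 < eps ->
    exists s, delta_cover_sum h delta F s /\ s < eps.

Definition Hpos (h : R -> R) (F : R2 -> Prop) : Prop := ~ Hnull h F.

Definition gauge_pow (s : R) (x : R) : R :=
  if Rle_dec x 0 then 0 else Rpower x s.

(* gauge x |-> 1 / log(1/x) for small x > 0 (here 0 < x < 1/2), 0 at 0,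
   extended continuously and non-decreasingly by the constant 1/log 2. *)
Definition gauge_log (x : R) : R :=
  if Rle_dec x 0 then 0
  else if Rlt_dec x (1/2) then / ln (/ x) else / ln 2.

Definition unit_circle (e : R2) : Prop := fst e ^ 2 + snd e ^ 2 = 1.

Definition segment (a e : R2) (l : R) (x : R2) : Prop :=
  exists t, 0 <= t <= l /\ x = (fst a + t * fst e, snd a + t * snd e).

Definition F_hg_set (h g : R -> R) (E : R2 -> Prop) : Prop :=
  exists L : R2 -> Prop,
    (forall e, L e -> unit_circle e) /\
    Hpos g L /\
    exists deltaE, 0 < deltaE /\
      forall e, L e -> exists (a : R2) (l : R),
        forall delta, 0 < delta < deltaE ->
          Hcontent_gt h delta (fun x => segment a e l x /\ E x) 1.

Definition hausdorff_dim (E : R2 -> Prop) (d : R) : Prop :=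
  (forall s, 0 <= s -> Hnull (gauge_pow s) E -> d <= s) /\
  (forall d', (forall s, 0 <= s -> Hnull (gauge_pow s) E -> d' <= s) -> d' <= d).

(* Main.v *)
Require Import Defs.
From Stdlib Require Import ZArith Reals Lra Lia List Cantor Classical ClassicalEpsilon.
Open Scope R_scope.

(* Suppose E is null for the exponent s < beta/2, and cover E by sets A_i of small diameters d_i
   with small sum of d_i^s. Group the diameters into the scales [delta^q, delta], where
   delta = exp(-T q^k) and q > 1 is close to 1. If on a line the pieces of every scale lay
   within distance delta^gam of each other, the gauge 1/log(1/x) would sum over the scales to a
   geometric series, at most 1. Hence every direction of L is that of a chord longer than
   delta^gam joining some A_i and A_j of one scale. Such directions form a set of diameter at
   most 2 delta^(1-gam) <= 2 (d_i d_j)^(s/beta), so the sum of the beta-th powers of these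
   diameters over all pairs is at most 2 (sum d_i^s)^2, and L is null for beta. *)

(** * Estimates for the two gauges *)

Lemma Rabs_le_inv (x y : R) : Rabs x <= y -> - y <= x <= y.
Proof. unfold Rabs; destruct (Rcase_abs x); lra. Qed.

Lemma gauge_pow_nonneg (s x : R) : 0 <= gauge_pow s x.
Proof.
  unfold gauge_pow; destruct (Rle_dec x 0); [lra|].
  left; apply exp_pos.
Qed.

Lemma gauge_pow_pos_eq (s x : R) : 0 < x -> gauge_pow s x = exp (s * ln x).
Proof.
  intros Hx; unfold gauge_pow, Rpower; destruct (Rle_dec x 0); [lra|reflexivity].
Qed.

Lemma ln_le_compat (x y : R) : 0 < x -> x <= y -> ln x <= ln y.
Proof.
  intros Hx [H| ->]; [left; now apply ln_increasing | lra].
Qed.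

Lemma exp_le_compat (x y : R) : x <= y -> exp x <= exp y.
Proof.
  intros [H| ->]; [left; now apply exp_increasing | lra].
Qed.

Lemma gauge_pow_le (s x y : R) : 0 <= s -> x <= y -> gauge_pow s x <= gauge_pow s y.
Proof.
  intros Hs Hxy; destruct (Rle_lt_dec x 0) as [Hx|Hx].
  - unfold gauge_pow at 1; destruct (Rle_dec x 0); [apply gauge_pow_nonneg|lra].
  - rewrite !gauge_pow_pos_eq by lra.
    apply exp_le_compat, Rmult_le_compat_l, ln_le_compat; lra.
Qed.

Lemma gauge_pow_0 (s x : R) : x <= 0 -> gauge_pow s x = 0.
Proof.
  intros Hx; unfold gauge_pow; destruct (Rle_dec x 0); [reflexivity|lra].
Qed.

Lemma exp_neg_lt_half (u : R) : 1 <= u -> exp (- u) < 1 / 2.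
Proof.
  intros Hu; rewrite exp_Ropp.
  assert (2 < exp u) by (pose proof (exp_ineq1 u); lra).
  replace (1 / 2) with (/ 2) by lra.
  apply Rinv_lt_contravar; lra.
Qed.

(** Since [1 <= u], a positive [d] lies below 1/2, where the gauge is 1/log(1/d), and the bound on
    [d] reads log(1/d) >= u. *)
Lemma gauge_log_le_inv (u d : R) : 1 <= u -> d <= exp (- u) -> 0 <= gauge_log d <= / u.
Proof.
  intros Hu Hd; pose proof (exp_neg_lt_half u Hu).
  unfold gauge_log; destruct (Rle_dec d 0).
  - split; [lra|]; left; apply Rinv_0_lt_compat; lra.
  - destruct (Rlt_dec d (1 / 2)); [|lra].
    assert (u <= ln (/ d)).
    { rewrite ln_Rinv by lra.
      pose proof (ln_le_compat d (exp (- u))) as Hl; rewrite ln_exp in Hl; lra. }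
    split; [left; apply Rinv_0_lt_compat; lra|apply Rinv_le_contravar; lra].
Qed.

Lemma gauge_log_0 (d : R) : d <= 0 -> gauge_log d = 0.
Proof.
  intros Hd; unfold gauge_log; destruct (Rle_dec d 0); [reflexivity|lra].
Qed.

(** * Diameters and the construction of covers *)

Lemma is_diam_exists (A : R2 -> Prop) (D : R) :
  (forall x y, A x -> A y -> dist2 x y <= D) -> exists d, is_diam A d.
Proof.
  intros HD.
  destruct (completeness (fun r => r = 0 \/ exists x y, A x /\ A y /\ r = dist2 x y))
    as [d [Hub Hlub]].
  - exists (Rmax 0 D); intros r [-> | (x & y & Hx & Hy & ->)].
    + apply Rmax_l.
    + eapply Rle_trans; [now apply HD|apply Rmax_r].
  - exists 0; now left.
  - exists d; repeat split.
    + apply Hub; now left.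
    + intros x y Hx Hy; apply Hub; right; now exists x, y.
    + intros d' Hd' H; apply Hlub; intros r [-> | (x & y & Hx & Hy & ->)]; auto.
Qed.

Lemma is_diam_le (A : R2 -> Prop) (d D : R) :
  is_diam A d -> 0 <= D -> (forall x y, A x -> A y -> dist2 x y <= D) -> d <= D.
Proof. intros (_ & _ & H) HD HA; now apply H. Qed.

Lemma is_diam_empty (A : R2 -> Prop) (d : R) : is_diam A d -> (forall x, ~ A x) -> d = 0.
Proof.
  intros Hd HA; apply Rle_antisym; [|apply Hd].
  apply (is_diam_le A d 0 Hd); [lra|]; intros x y Hx; now destruct (HA x).
Qed.

(** Builds covers from sets whose diameters are only estimated: exact diameters come from choice,
    and the partial sums converge because they increase and stay below [S]. *)
Lemma delta_cover_sum_exists (h : R -> R) (delta : R) (F : R2 -> Prop)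
    (A : nat -> R2 -> Prop) (b : nat -> R) (S : R) :
  (forall i, exists D, forall x y, A i x -> A i y -> dist2 x y <= D) ->
  (forall i d, is_diam (A i) d -> d < delta /\ 0 <= h d <= b i) ->
  (forall x, F x -> exists i, A i x) ->
  (forall N, sum_f_R0 b N <= S) ->
  exists s, delta_cover_sum h delta F s /\ s <= S.
Proof.
  intros HB Hd HF HS.
  destruct (choice (fun i d => is_diam (A i) d)) as [d Hdiam].
  { intros i; destruct (HB i) as [D HD]; now apply is_diam_exists with D. }
  assert (Hsum : forall N, sum_f_R0 (fun i => h (d i)) N <= S).
  { intros N; eapply Rle_trans; [apply sum_Rle; intros; now apply Hd|apply HS]. }
  destruct (Un_cv_crit (fun N => sum_f_R0 (fun i => h (d i)) N)) as [s Hs].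
  - intros n; simpl; pose proof (proj2 (Hd _ _ (Hdiam (Datatypes.S n)))); lra.
  - exists S; intros r [n ->]; apply Hsum.
  - exists s; split.
    + exists A, d; split; [|now split].
      intros i; split; [apply Hdiam|exact (proj1 (Hd i _ (Hdiam i)))].
    + destruct (Rle_lt_dec s S) as [|Hlt]; [assumption|exfalso].
      destruct (Hs (s - S)) as [N HN]; [lra|].
      specialize (HN N (le_n N)); specialize (Hsum N).
      unfold Rdist in HN; rewrite Rabs_left in HN; lra.
Qed.

(** * Finite sums and sums over pairs *)

Definition list_sum {X : Type} (f : X -> R) (l : list X) : R :=
  fold_right (fun x r => f x + r) 0 l.

Lemma list_sum_app {X : Type} (f : X -> R) (l1 l2 : list X) :
  list_sum f (l1 ++ l2) = list_sum f l1 + list_sum f l2.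
Proof. induction l1 as [|x l1 IH]; simpl; [lra|rewrite IH; lra]. Qed.

Lemma list_sum_nonneg {X : Type} (f : X -> R) (l : list X) :
  (forall x, 0 <= f x) -> 0 <= list_sum f l.
Proof. intros Hf; induction l as [|x l IH]; simpl; [lra|specialize (Hf x); lra]. Qed.

Lemma list_sum_incl {X : Type} (f : X -> R) (l l' : list X) :
  (forall x, 0 <= f x) -> NoDup l -> incl l l' -> list_sum f l <= list_sum f l'.
Proof.
  intros Hf Hl; revert l'; induction Hl as [|x l Hx Hl IH]; intros l' Hi.
  - now apply list_sum_nonneg.
  - destruct (in_split x l') as (l1 & l2 & ->); [apply Hi; now left|].
    assert (list_sum f l <= list_sum f (l1 ++ l2)).
    { apply IH; intros y Hy.
      assert (Hy' : In y (l1 ++ x :: l2)) by (apply Hi; now right).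
      apply in_app_iff in Hy'; apply in_app_iff; destruct Hy' as [|[->|]]; tauto. }
    rewrite list_sum_app in *; simpl; lra.
Qed.

Lemma list_sum_map {X Y : Type} (f : Y -> R) (g : X -> Y) (l : list X) :
  list_sum f (map g l) = list_sum (fun x => f (g x)) l.
Proof. induction l as [|x l IH]; simpl; [lra|now rewrite IH]. Qed.

Lemma list_sum_scal {X : Type} (f : X -> R) (c : R) (l : list X) :
  list_sum (fun x => c * f x) l = c * list_sum f l.
Proof. induction l as [|x l IH]; simpl; [lra|rewrite IH; lra]. Qed.

Lemma list_sum_prod {X Y : Type} (f : X -> R) (g : Y -> R) (l : list X) (l' : list Y) :
  list_sum (fun p => f (fst p) * g (snd p)) (list_prod l l') = list_sum f l * list_sum g l'.
Proof.
  induction l as [|x l IH]; simpl; [lra|].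
  rewrite list_sum_app, IH, list_sum_map; simpl; rewrite list_sum_scal; lra.
Qed.

Lemma sum_f_R0_list_sum (f : nat -> R) (N : nat) :
  sum_f_R0 f N = list_sum f (seq 0 (S N)).
Proof.
  induction N as [|N IH]; [simpl; lra|].
  rewrite seq_S, list_sum_app, <- IH; simpl; lra.
Qed.

(** Decoding is injective, and codes up to [N] give pairs with both entries at most [N]; so the sum
    is part of the sum over a full square, which factors. *)
Lemma cantor_product_sum_le (a b : nat -> R) (SA SB : R) (N : nat) :
  (forall n, 0 <= a n) -> (forall n, 0 <= b n) ->
  (forall n, sum_f_R0 a n <= SA) -> (forall n, sum_f_R0 b n <= SB) ->
  sum_f_R0 (fun n => a (fst (of_nat n)) * b (snd (of_nat n))) N <= SA * SB.
Proof.
  intros Ha Hb HA HB.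
  rewrite sum_f_R0_list_sum.
  rewrite <- (list_sum_map (fun p => a (fst p) * b (snd p)) of_nat).
  apply Rle_trans with
    (list_sum (fun p => a (fst p) * b (snd p)) (list_prod (seq 0 (S N)) (seq 0 (S N)))).
  - apply list_sum_incl.
    + intros x; now apply Rmult_le_pos.
    + apply NoDup_map_NoDup_ForallPairs; [|apply seq_NoDup].
      intros m n _ _ Hmn; rewrite <- (cancel_to_of m), <- (cancel_to_of n); now rewrite Hmn.
    + intros [i j] Hij; apply in_map_iff in Hij; destruct Hij as (n & Hn & Hin).
      apply in_seq in Hin.
      pose proof (to_nat_non_decreasing i j) as Hle; rewrite <- Hn, cancel_to_of in Hle.
      apply in_prod; apply in_seq; lia.
  - rewrite list_sum_prod, <- !sum_f_R0_list_sum.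
    apply Rmult_le_compat; auto; now apply cond_pos_sum.
Qed.

(** * Nullity of the plane for a large exponent *)

Lemma inv_square_sum_le (N : nat) : sum_f_R0 (fun n => / INR (S n) ^ 2) N <= 2.
Proof.
  (* The sharper bound telescopes, by 1/(x+1)^2 <= 1/x - 1/(x+1). *)
  apply Rle_trans with (2 - / INR (S N)).
  - induction N as [|N IH]; [simpl; lra|].
    rewrite tech5; assert (0 < INR (S N)) by (apply lt_0_INR; lia).
    rewrite (S_INR (S N)); set (x := INR (S N)) in *.
    assert (/ (x + 1) ^ 2 <= / x - / (x + 1)); [|lra].
    replace (/ x - / (x + 1)) with (/ (x * (x + 1))) by (field; lra).
    apply Rinv_le_contravar; nra.
  - assert (0 < / INR (S N)) by (apply Rinv_0_lt_compat, lt_0_INR; lia); lra.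
Qed.

Lemma nat_floor (y : R) : 0 <= y -> exists n, INR n <= y < INR n + 1.
Proof.
  intros Hy; destruct (archimed y) as [H1 H2].
  assert (Hpos : (0 <= up y - 1)%Z).
  { assert (0 < up y)%Z by (apply lt_IZR; simpl; lra); lia. }
  exists (Z.to_nat (up y - 1)).
  rewrite INR_IZR_INZ, Z2Nat.id, minus_IZR by assumption; lra.
Qed.

Lemma dist2_le_of_coords (p q : R2) (D : R) :
  Rabs (fst p - fst q) <= D -> Rabs (snd p - snd q) <= D -> dist2 p q <= 2 * D.
Proof.
  intros H1 H2; unfold dist2.
  assert (0 <= D) by (eapply Rle_trans; [apply Rabs_pos|apply H1]).
  rewrite <- (sqrt_pow2 (2 * D)) by lra.
  apply sqrt_le_1_alt.
  pose proof (Rsqr_le_abs_1 (fst p - fst q) D) as K1.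
  pose proof (Rsqr_le_abs_1 (snd p - snd q) D) as K2.
  rewrite (Rabs_right D) in K1, K2 by lra; unfold Rsqr in *.
  specialize (K1 H1); specialize (K2 H2); nra.
Qed.

(** With M = [INR (S m)], the index [a] is the floor of M(y + M), at most 2M^2. This polynomial
    bound keeps the weights of the cells in [plane_null] from being too small. *)
Lemma cover_coordinate (y : R) (m : nat) :
  Rabs y <= INR (S m) ->
  exists a, Rabs (y - (INR a / INR (S m) - INR (S m))) <= / INR (S m) /\
            INR (S a) <= 3 * INR (S m) ^ 2.
Proof.
  intros Hy.
  assert (HM : 1 <= INR (S m)) by (rewrite S_INR; pose proof (pos_INR m); lra).
  set (M := INR (S m)) in *.
  apply Rabs_le_inv in Hy.
  destruct (nat_floor (M * (y + M))) as [a [Ha1 Ha2]]; [apply Rmult_le_pos; lra|].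
  exists a; split.
  - replace (y - (INR a / M - M)) with ((M * (y + M) - INR a) * / M) by (field; lra).
    assert (0 < / M) by (apply Rinv_0_lt_compat; lra).
    rewrite Rabs_right by (apply Rle_ge, Rmult_le_pos; lra).
    rewrite <- (Rmult_1_l (/ M)) at 2; apply Rmult_le_compat_r; lra.
  - rewrite S_INR; nra.
Qed.

(* The cells of the grids of mesh [1/(m+1)], m = 0, 1, ..., are numbered by Cantor pairing;
   a cell is kept only if its cost is below a summable weight that is polynomial in its indices,
   which holds for all cells near a given point once m is large since 11 > 10. *)
Lemma plane_null : Hnull (gauge_pow 11) (fun _ => True).
Proof.
  intros delta Hdelta eps Heps.
  pose (w := fun n => / INR (S n) ^ 2).
  assert (Hw : forall n, 0 < w n).
  { intros n; apply Rinv_0_lt_compat, pow_lt, lt_0_INR; lia. }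
  (* The weights sum to at most 8 [c], that is [eps / 2]. *)
  pose (c := eps / 16).
  pose (M := fun n => INR (S (fst (of_nat n)))).
  assert (HM : forall n, 0 < M n) by (intros n; apply lt_0_INR; lia).
  pose (i1 := fun n => fst (of_nat (snd (of_nat n)))).
  pose (i2 := fun n => snd (of_nat (snd (of_nat n)))).
  pose (b := fun n => (c * w (fst (of_nat n))) * (w (i1 n) * w (i2 n))).
  assert (Hb : forall n, 0 < b n).
  { intros n; unfold b, c; pose proof (Hw (fst (of_nat n))); pose proof (Hw (i1 n));
      pose proof (Hw (i2 n)); repeat apply Rmult_lt_0_compat; lra. }
  (* The last two conditions do not depend on [p]: a cell that fails them becomes the empty set,
     which costs 0. *)
  pose (A := fun n (p : R2) =>
    Rabs (fst p - (INR (i1 n) / M n - M n)) <= / M n /\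
    Rabs (snd p - (INR (i2 n) / M n - M n)) <= / M n /\
    4 / M n < delta /\ (4 / M n) ^ 11 <= b n).
  assert (HA : forall n x y, A n x -> A n y -> dist2 x y <= 4 / M n).
  { intros n x y (H1 & H2 & _) (H3 & H4 & _).
    replace (4 / M n) with (2 * (2 / M n)) by (field; pose proof (HM n); lra).
    apply dist2_le_of_coords; apply Rabs_le_inv in H1, H2, H3, H4; apply Rabs_le; lra. }
  destruct (delta_cover_sum_exists (gauge_pow 11) delta (fun _ => True) A b (c * 2 * (2 * 2)))
    as [s [Hs Hle]].
  - intros n; exists (4 / M n); apply HA.
  - intros n d Hd.
    destruct (classic (exists x, A n x)) as [[x (_ & _ & Hx1 & Hx2)]|Hempty].
    + assert (H4 : 0 < 4 / M n) by (apply Rdiv_lt_0_compat; [lra|apply HM]).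
      assert (Hd' : d <= 4 / M n) by (apply (is_diam_le (A n)); [assumption|lra|apply HA]).
      split; [lra|split; [apply gauge_pow_nonneg|]].
      apply Rle_trans with (gauge_pow 11 (4 / M n)); [apply gauge_pow_le; lra|].
      rewrite gauge_pow_pos_eq by assumption.
      replace 11 with (INR 11) by (simpl; lra).
      change (Rpower (4 / M n) (INR 11) <= b n); rewrite Rpower_pow; assumption.
    + rewrite (is_diam_empty (A n) d Hd); [|intros x Hx; apply Hempty; now exists x].
      rewrite gauge_pow_0 by lra; pose proof (Hb n); lra.
  - intros [x y] _.
    assert (Hc : 0 < c) by (unfold c; lra).
    (* The summands serve in turn to put [x] and [y] inside the grid, to make the cells smaller than
       [delta], and to bring the cost below the weight. *)
    destruct (INR_unbounded (Rabs x + Rabs y + 4 / delta + 4 ^ 11 * 81 / c)) as [m Hm].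
    assert (Hm' : Rabs x + Rabs y + 4 / delta + 4 ^ 11 * 81 / c < INR (S m))
      by (rewrite S_INR; lra).
    pose proof (Rabs_pos x); pose proof (Rabs_pos y).
    assert (0 < 4 / delta) by (apply Rdiv_lt_0_compat; lra).
    assert (0 < 4 ^ 11 * 81 / c) by (apply Rdiv_lt_0_compat; lra).
    destruct (cover_coordinate x m) as [i [Hi Hi']]; [lra|].
    destruct (cover_coordinate y m) as [j [Hj Hj']]; [lra|].
    exists (to_nat (m, to_nat (i, j))).
    unfold A, b, M, i1, i2; rewrite !cancel_of_to; cbn [fst snd].
    rewrite !cancel_of_to; cbn [fst snd].
    assert (HK : 0 < INR (S m)) by (apply lt_0_INR; lia).
    split; [assumption|split; [assumption|split]].
    + apply Rmult_lt_reg_r with (INR (S m) / delta); [apply Rdiv_lt_0_compat; lra|].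
      replace (4 / INR (S m) * (INR (S m) / delta)) with (4 / delta) by (field; lra).
      replace (delta * (INR (S m) / delta)) with (INR (S m)) by (field; lra); lra.
    + assert (Hwk : forall k, INR (S k) <= 3 * INR (S m) ^ 2 -> / (9 * INR (S m) ^ 4) <= w k).
      { intros k Hk; assert (0 < INR (S k)) by (apply lt_0_INR; lia).
        apply Rinv_le_contravar; [now apply pow_lt|].
        replace (9 * INR (S m) ^ 4) with ((3 * INR (S m) ^ 2) ^ 2) by ring.
        apply pow_incr; lra. }
      pose proof (Hwk _ Hi') as Wi; pose proof (Hwk _ Hj') as Wj; clear Hwk.
      set (K := INR (S m)) in *.
      assert (0 < / (9 * K ^ 4)) by (apply Rinv_0_lt_compat; pose proof (pow_lt K 4 HK); lra).
      apply Rle_trans with (c * w m * (/ (9 * K ^ 4) * / (9 * K ^ 4))).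
      * unfold w at 1; fold K.
        replace (c * / K ^ 2 * (/ (9 * K ^ 4) * / (9 * K ^ 4)))
          with (c / (81 * K ^ 10)) by (field; lra).
        apply Rmult_le_reg_r with (81 * K ^ 11 / c).
        { apply Rdiv_lt_0_compat; [pose proof (pow_lt K 11 HK); lra|lra]. }
        replace ((4 / K) ^ 11 * (81 * K ^ 11 / c)) with (4 ^ 11 * 81 / c) by (field; lra).
        replace (c / (81 * K ^ 10) * (81 * K ^ 11 / c)) with K by (field; lra); lra.
      * apply Rmult_le_compat_l; [|apply Rmult_le_compat; lra].
        apply Rmult_le_pos; [lra|left; apply Hw].
  - intros N; unfold b.
    assert (Hw0 : forall n, 0 <= w n) by (intros n; left; apply Hw).
    apply (cantor_product_sum_le (fun m => c * w m)
             (fun n => w (fst (of_nat n)) * w (snd (of_nat n)))).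
    + intros n; apply Rmult_le_pos; [unfold c; lra|apply Hw0].
    + intros n; now apply Rmult_le_pos.
    + intros n.
      rewrite (sum_eq _ (fun i => w i * c)) by (intros; ring).
      rewrite <- scal_sum; apply Rmult_le_compat_l; [unfold c; lra|apply inv_square_sum_le].
    + intros n; apply cantor_product_sum_le; auto using inv_square_sum_le.
  - exists s; split; [assumption|unfold c in Hle; lra].
Qed.

(** * Existence of the Hausdorff dimension *)

Lemma Hnull_subset (h : R -> R) (F G : R2 -> Prop) :
  (forall x, F x -> G x) -> Hnull h G -> Hnull h F.
Proof.
  intros HFG HG delta Hdelta eps Heps.
  destruct (HG delta Hdelta eps Heps) as (s & (A & d & HA & Hcov & Hs) & Hlt).
  exists s; split; [exists A, d; auto|assumption].
Qed.

(** The dimension is an infimum of exponents, obtained as a supremum of their opposites;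
    [plane_null] shows that there is at least one exponent. *)
Lemma hausdorff_dim_ge (E : R2 -> Prop) (t : R) :
  (forall s, 0 <= s -> Hnull (gauge_pow s) E -> t <= s) ->
  exists d, hausdorff_dim E d /\ t <= d.
Proof.
  intros Ht.
  destruct (completeness (fun r => 0 <= - r /\ Hnull (gauge_pow (- r)) E)) as [m [Hub Hlub]].
  - exists 0; intros r [Hr _]; lra.
  - exists (-11); split; [lra|].
    replace (- -11) with 11 by lra; apply (Hnull_subset _ _ (fun _ => True)); auto using plane_null.
  - assert (Hglb : forall d', (forall s, 0 <= s -> Hnull (gauge_pow s) E -> d' <= s) -> d' <= - m).
    { intros d' Hd'; assert (m <= - d'); [|lra].
      apply Hlub; intros r [Hr1 Hr2]; specialize (Hd' _ Hr1 Hr2); lra. }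
    exists (- m); split; [split; [|assumption]|now apply Hglb].
    intros s Hs Hn; assert (- s <= m); [|lra].
    apply Hub; rewrite Ropp_involutive; auto.
Qed.

(** * Directions of long chords between small sets *)

(* With [w = t e - t' e'], one has [|w|^2 = (t - t')^2 + t t' |e - e'|^2]. *)
Lemma direction_dist_le (e e' x x' y y' : R2) (t t' p r m : R) :
  unit_circle e -> unit_circle e' -> 0 < t -> 0 < t' -> 0 <= m ->
  x = (fst y + t * fst e, snd y + t * snd e) ->
  x' = (fst y' + t' * fst e', snd y' + t' * snd e') ->
  dist2 x x' <= p -> dist2 y y' <= r -> p + r <= m * t -> p + r <= m * t' ->
  dist2 e e' <= m.
Proof.
  destruct e as [e1 e2], e' as [f1 f2], y as [y1 y2], y' as [z1 z2].
  unfold unit_circle, dist2; cbn [fst snd]; intros He Hf Ht Ht' Hm -> -> Hp Hr H1 H2.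
  cbn [fst snd] in *.
  (* With the origin as third point, this bounds the length of (x - x') - (y - y') = t e - t' e' by
     [p + r]. *)
  pose proof (triangle (y1 + t * e1 - (z1 + t' * f1)) (y2 + t * e2 - (z2 + t' * f2))
                (y1 - z1) (y2 - z2) 0 0) as Htri.
  unfold dist_euc in Htri; rewrite !Rsqr_pow2 in Htri.
  rewrite !Rminus_0_r, !Rminus_0_l, <- !Rsqr_pow2, <- !Rsqr_neg, !Rsqr_pow2 in Htri.
  set (W := sqrt ((y1 + t * e1 - (z1 + t' * f1) - (y1 - z1)) ^ 2 +
    (y2 + t * e2 - (z2 + t' * f2) - (y2 - z2)) ^ 2)) in *.
  assert (HW0 : 0 <= W) by apply sqrt_pos.
  assert (HW : W ^ 2 = (t - t') ^ 2 + t * t' * ((e1 - f1) ^ 2 + (e2 - f2) ^ 2)).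
  { unfold W; rewrite pow2_sqrt; [|apply Rplus_le_le_0_compat; apply pow2_ge_0].
    transitivity (t ^ 2 * (e1 ^ 2 + e2 ^ 2) + t' ^ 2 * (f1 ^ 2 + f2 ^ 2)
                  - 2 * t * t' * (e1 * f1 + e2 * f2)); [ring|].
    transitivity ((t - t') ^ 2 + t * t' * (e1 ^ 2 + e2 ^ 2 + (f1 ^ 2 + f2 ^ 2)
                  - 2 * (e1 * f1 + e2 * f2))); [|ring].
    rewrite He, Hf; ring. }
  assert (W ^ 2 <= m ^ 2 * (t * t')).
  (* Multiplying the bounds [m * t] and [m * t'] on [W] produces the factor [t * t'] that also
     stands in [HW]. *)
  { replace (m ^ 2 * (t * t')) with ((m * t) * (m * t')) by ring.
    simpl; rewrite Rmult_1_r; apply Rmult_le_compat; lra. }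
  rewrite <- (sqrt_pow2 m) by assumption; apply sqrt_le_1_alt.
  apply Rmult_le_reg_r with (t * t'); [now apply Rmult_lt_0_compat|].
  pose proof (pow2_ge_0 (t - t')); lra.
Qed.

(** * Scales and the logarithmic content of a line *)

(** Neighbouring scales share an endpoint, which is harmless: only the existence of a scale is
    used. *)
Definition in_scale (T q : R) (k : nat) (d : R) : Prop :=
  exp (- (T * q ^ S k)) <= d <= exp (- (T * q ^ k)).

Lemma in_scale_exists (T q d : R) :
  0 < T -> 1 < q -> 0 < d < exp (- T) -> exists k, in_scale T q k d.
Proof.
  intros HT Hq [Hd HdT].
  assert (Hl : T <= - ln d).
  { pose proof (ln_le_compat d (exp (- T))) as Hl; rewrite ln_exp in Hl; lra. }
  destruct (Pow_x_infinity q) with (b := - ln d / T) as [n Hn].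
  { rewrite Rabs_right; lra. }
  specialize (Hn n (le_n n)).
  rewrite Rabs_right in Hn by (apply Rle_ge, pow_le; lra).
  assert (Hln : - ln d <= T * q ^ n).
  { apply Rge_le, (Rmult_le_compat_l T) in Hn; [|lra].
    replace (T * (- ln d / T)) with (- ln d) in Hn by (field; lra); assumption. }
  assert (Hk : exists k, T * q ^ k <= - ln d <= T * q ^ S k).
  { clear Hn; induction n as [|n IH].
    - exists 0%nat; simpl in *; nra.
    - destruct (Rle_lt_dec (- ln d) (T * q ^ n)); [auto|exists n; lra]. }
  destruct Hk as [k Hk]; exists k; unfold in_scale.
  rewrite <- (exp_ln d) by assumption; split; apply exp_le_compat; lra.
Qed.

Lemma scale_ge (T q : R) (k : nat) : 0 < T -> 1 < q -> T <= T * q ^ k.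
Proof. intros HT Hq; pose proof (pow_R1_Rle q k); nra. Qed.

Lemma geometric_inv_sum_le (u q : R) (N : nat) :
  0 < u -> 1 < q -> sum_f_R0 (fun k => / (u * q ^ k)) N <= / u * (q / (q - 1)).
Proof.
  intros Hu Hq.
  assert (0 < / q) by (apply Rinv_0_lt_compat; lra).
  assert (/ q < 1) by (rewrite <- Rinv_1; apply Rinv_lt_contravar; lra).
  rewrite (sum_eq _ (fun k => (/ q) ^ k * / u)).
  2: { intros k _; rewrite Rinv_mult, pow_inv; ring. }
  rewrite <- scal_sum; apply Rmult_le_compat_l; [left; now apply Rinv_0_lt_compat|].
  rewrite tech3 by lra.
  replace (q / (q - 1)) with (1 / (1 - / q)) by (field; lra).
  apply Rmult_le_compat_r; [left; apply Rinv_0_lt_compat; lra|].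
  pose proof (pow_le (/ q) (S N)); lra.
Qed.

Lemma dist2_on_line (y e : R2) (t : R) :
  unit_circle e -> dist2 (fst y + t * fst e, snd y + t * snd e) y = Rabs t.
Proof.
  intros He; unfold dist2; cbn [fst snd].
  replace ((fst y + t * fst e - fst y) ^ 2 + (snd y + t * snd e - snd y) ^ 2)
    with (t ^ 2 * (fst e ^ 2 + snd e ^ 2)) by ring.
  rewrite He, Rmult_1_r, <- Rsqr_pow2; apply sqrt_Rsqr_abs.
Qed.

(* If on every scale the pieces lie within a ball whose radius is a fixed power of that scale,
   the logarithmic gauge sees a geometric series over the scales; the sets of diameter zero
   are points and cost nothing. *)
Lemma line_log_content_small (a e : R2) (l : R) (F : R2 -> Prop)
    (A : nat -> R2 -> Prop) (d : nat -> R) (T q gam delta : R) :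
  unit_circle e -> 0 < T -> 1 < q -> 1 <= gam * T -> exp (- (gam * T)) < delta ->
  (forall x, F x -> segment a e l x) ->
  (forall i, is_diam (A i) (d i) /\ d i < exp (- T)) ->
  (forall x, F x -> exists i, A i x) ->
  (forall i j k x y t, A i x -> A j y -> in_scale T q k (d i) -> in_scale T q k (d j) ->
     x = (fst y + t * fst e, snd y + t * snd e) -> t <= exp (- (gam * T * q ^ k))) ->
  exists s, delta_cover_sum gauge_log delta F s /\ s <= / (gam * T) * (q / (q - 1)).
Proof.
  intros He HT Hq Hgam Hdelta Hseg HA Hcov Hsep.
  (* Selects the pairs with first entry 0, so that the sum over codes is bounded by a product whose
     first factor is 1. *)
  pose (alpha := fun p : nat => match p with 0 => 1 | S _ => 0 end).
  (* Code (0, k) collects the pieces of scale [k], code (1, i) is a piece of diameter zero, and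
     every other code is the empty set. *)
  pose (B := fun n x => F x /\
    match fst (of_nat n) with
    | 0 => exists i, A i x /\ in_scale T q (snd (of_nat n)) (d i)
    | 1 => A (snd (of_nat n)) x /\ d (snd (of_nat n)) <= 0
    | _ => False
    end).
  pose (rho := fun n => match fst (of_nat n) with
    | 0 => exp (- (gam * T * q ^ snd (of_nat n))) | _ => 0 end).
  assert (Hrho : forall n, 0 <= rho n).
  { intros n; unfold rho; destruct (fst (of_nat n)); [left; apply exp_pos|lra]. }
  assert (HB : forall n x y, B n x -> B n y -> dist2 x y <= rho n).
  { intros n x y [HFx Hx] [HFy Hy]; unfold rho.
    destruct (fst (of_nat n)) as [|[|p]]; [| |contradiction].
    - destruct Hx as (i & Hi & Hki), Hy as (j & Hj & Hkj).
      destruct (Hseg x HFx) as (t & _ & Ht), (Hseg y HFy) as (t' & _ & Ht').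
      (* [Hsep] bounds a signed parameter, so it is applied in both orders. *)
      assert (Exy : x = (fst y + (t - t') * fst e, snd y + (t - t') * snd e))
        by (subst x y; cbn [fst snd]; f_equal; ring).
      assert (Eyx : y = (fst x + (t' - t) * fst e, snd x + (t' - t) * snd e))
        by (subst x y; cbn [fst snd]; f_equal; ring).
      pose proof (Hsep _ _ _ _ _ _ Hi Hj Hki Hkj Exy).
      pose proof (Hsep _ _ _ _ _ _ Hj Hi Hkj Hki Eyx).
      rewrite Exy at 1; rewrite dist2_on_line by assumption; apply Rabs_le; lra.
    - destruct Hx as [Hx Hd], Hy as [Hy _].
      destruct (HA (snd (of_nat n))) as [[_ [Hdiam _]] _]; specialize (Hdiam x y Hx Hy); lra. }
  destruct (delta_cover_sum_exists gauge_log delta F B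
      (fun n => alpha (fst (of_nat n)) * / (gam * T * q ^ snd (of_nat n)))
      (1 * (/ (gam * T) * (q / (q - 1))))) as [s [Hs Hle]].
  - intros n; exists (rho n); apply HB.
  - intros n dn Hdn.
    assert (Hdr : dn <= rho n) by (apply (is_diam_le (B n)); auto).
    unfold rho, alpha in *; destruct (fst (of_nat n)) as [|p].
    + pose proof (scale_ge (gam * T) q (snd (of_nat n))) as Hge.
      rewrite Rmult_1_l; split; [|apply gauge_log_le_inv; lra].
      apply Rle_lt_trans with (1 := Hdr), Rle_lt_trans with (2 := Hdelta), exp_le_compat; lra.
    + rewrite gauge_log_0 by assumption; split; [pose proof (exp_pos (- (gam * T))); lra|lra].
  - intros x HFx; destruct (Hcov x HFx) as [i Hi].
    destruct (HA i) as [_ HdT].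
    destruct (Rle_lt_dec (d i) 0) as [Hd|Hd].
    + exists (to_nat (1%nat, i)); unfold B; rewrite cancel_of_to; cbn [fst snd]; auto.
    + destruct (in_scale_exists T q (d i)) as [k Hk]; auto.
      exists (to_nat (0%nat, k)); unfold B; rewrite cancel_of_to; cbn [fst snd].
      split; [assumption|now exists i].
  - intros N; apply (cantor_product_sum_le alpha (fun k => / (gam * T * q ^ k))).
    + intros [|n]; simpl; lra.
    + intros n; left; apply Rinv_0_lt_compat, Rmult_lt_0_compat; [lra|apply pow_lt; lra].
    + intros n; induction n as [|n IH]; [simpl; lra|rewrite tech5; simpl alpha; lra].
    + intros n; apply geometric_inv_sum_le; lra.
  - exists s; split; [assumption|lra].
Qed.

(** * Covering the set of directions *)

(** Pairs are ordered: [e] points from [A j] to [A i]. With sigma = exp(-T q^k), the chord is longer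
    than sigma^gam. *)
Definition chord_directions (L : R2 -> Prop) (A : nat -> R2 -> Prop) (d : nat -> R)
    (T q gam : R) (i j : nat) (e : R2) : Prop :=
  L e /\ exists k x y t, A i x /\ A j y /\ in_scale T q k (d i) /\ in_scale T q k (d j) /\
    exp (- (gam * T * q ^ k)) < t /\ x = (fst y + t * fst e, snd y + t * snd e).

(** The end sets have diameter at most sigma = exp(-T q^k) and the chords exceed sigma^gam, so
    [direction_dist_le] applies with 2 sigma^(1-gam). The two directions may use different scales,
    hence a bound [m] valid for every scale shared by [d i] and [d j]. *)
Lemma chord_directions_dist_le (L : R2 -> Prop) (A : nat -> R2 -> Prop) (d : nat -> R)
    (T q gam m : R) (i j : nat) (e e' : R2) :
  (forall e, L e -> unit_circle e) -> (forall i, is_diam (A i) (d i)) ->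
  (forall k, in_scale T q k (d i) -> in_scale T q k (d j) ->
     2 * exp (- ((1 - gam) * (T * q ^ k))) <= m) ->
  chord_directions L A d T q gam i j e -> chord_directions L A d T q gam i j e' ->
  dist2 e e' <= m.
Proof.
  intros HL HA Hm (He & k & x & y & t & Hx & Hy & Hi & Hj & Ht & Exy)
    (He' & k' & x' & y' & t' & Hx' & Hy' & Hi' & Hj' & Ht' & Exy').
  assert (Hlen : forall k t, in_scale T q k (d i) -> in_scale T q k (d j) ->
                 exp (- (gam * T * q ^ k)) < t -> 0 < t /\ d i + d j <= m * t).
  { clear - Hm; intros k t Hi Hj Ht; specialize (Hm k Hi Hj).
    pose proof (exp_pos (- (gam * T * q ^ k))).
    pose proof (exp_pos (- ((1 - gam) * (T * q ^ k)))).
    split; [lra|destruct Hi as [_ Hi], Hj as [_ Hj]].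
    apply Rle_trans with (2 * exp (- ((1 - gam) * (T * q ^ k))) * exp (- (gam * T * q ^ k))).
    - rewrite Rmult_assoc, <- exp_plus.
      replace (- ((1 - gam) * (T * q ^ k)) + - (gam * T * q ^ k)) with (- (T * q ^ k)) by ring.
      lra.
    - apply Rmult_le_compat; lra. }
  destruct (Hlen k t Hi Hj Ht), (Hlen k' t' Hi' Hj' Ht').
  assert (0 <= m).
  { pose proof (Hm k Hi Hj); pose proof (exp_pos (- ((1 - gam) * (T * q ^ k)))); lra. }
  apply (direction_dist_le e e' x x' y y' t t' (d i) (d j)); auto; now apply HA.
Qed.

(** The cover consists of the chord direction sets of all pairs. As both diameters are at least
    sigma^q for sigma = exp(-T q^k), the hypothesis on [2 * s * q] bounds 2 sigma^(1-gam) by 2 (d_i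
    d_j)^(s/beta), whose beta-th powers sum as a product. *)
Lemma directions_cover (beta s gam q T delta tau : R) (L : R2 -> Prop)
    (A : nat -> R2 -> Prop) (d : nat -> R) :
  0 < beta <= 1 -> 0 <= s -> 0 < T -> 1 < q -> gam < 1 ->
  2 * s * q <= beta * (1 - gam) ->
  2 * exp (- ((1 - gam) * T)) < delta ->
  (forall e, L e -> unit_circle e) -> (forall i, is_diam (A i) (d i)) ->
  (forall N, sum_f_R0 (fun i => gauge_pow s (d i)) N <= tau) ->
  (forall e, L e -> exists i j, chord_directions L A d T q gam i j e) ->
  exists r, delta_cover_sum (gauge_pow beta) delta L r /\ r <= 2 * tau * tau.
Proof.
  intros Hbeta Hs HT Hq Hgam Hexp Hdelta HL HA Htau Hcov.
  pose (D := fun n => chord_directions L A d T q gam (fst (of_nat n)) (snd (of_nat n))).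
  apply (delta_cover_sum_exists _ _ _ D
    (fun n => 2 * gauge_pow s (d (fst (of_nat n))) * gauge_pow s (d (snd (of_nat n))))).
  - intros n; exists (2 * exp (- ((1 - gam) * T))); intros e e'.
    apply chord_directions_dist_le; auto.
    intros k _ _; apply Rmult_le_compat_l, exp_le_compat; [lra|].
    pose proof (scale_ge T q k HT Hq); nra.
  - intros n m Hm; unfold D in Hm.
    set (i := fst (of_nat n)) in *; set (j := snd (of_nat n)) in *.
    pose proof (exp_pos (- ((1 - gam) * T))).
    pose proof (gauge_pow_nonneg s (d i)); pose proof (gauge_pow_nonneg s (d j)).
    (* A pair without chord directions costs 0; any other pair shares a scale, which makes both
       diameters positive. *)
    destruct (classic (exists e, chord_directions L A d T q gam i j e)) as [[e He]|Hempty].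
    2: { rewrite (is_diam_empty _ m Hm); [|intros e He; apply Hempty; now exists e].
         rewrite (gauge_pow_0 beta 0) by lra.
         split; [lra|split; [lra|repeat apply Rmult_le_pos; lra]]. }
    destruct He as (_ & k0 & _ & _ & _ & _ & _ & Hi0 & Hj0 & _).
    assert (Hi : 0 < d i) by (eapply Rlt_le_trans; [apply exp_pos|apply Hi0]).
    assert (Hj : 0 < d j) by (eapply Rlt_le_trans; [apply exp_pos|apply Hj0]).
    split; [|split; [apply gauge_pow_nonneg|]].
    + apply Rle_lt_trans with (2 := Hdelta), (is_diam_le _ _ _ Hm); [lra|].
      intros f f'; apply chord_directions_dist_le; auto.
      intros k _ _; apply Rmult_le_compat_l, exp_le_compat; [lra|].
      pose proof (scale_ge T q k HT Hq); nra.
    + pose (M := 2 * exp (s / beta * (ln (d i) + ln (d j)))).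
      assert (HM : 0 < M) by (apply Rmult_lt_0_compat; [lra|apply exp_pos]).
      apply Rle_trans with (gauge_pow beta M).
      * apply gauge_pow_le; [lra|]; apply (is_diam_le _ _ _ Hm); [lra|].
        intros f f'; apply chord_directions_dist_le; auto.
        intros k [Hki _] [Hkj _]; unfold M; apply Rmult_le_compat_l, exp_le_compat; [lra|].
        pose proof (ln_le_compat _ _ (exp_pos _) Hki) as Hli; rewrite ln_exp in Hli.
        pose proof (ln_le_compat _ _ (exp_pos _) Hkj) as Hlj; rewrite ln_exp in Hlj.
        simpl in Hli, Hlj.
        assert (HTq : 0 < T * q ^ k) by (apply Rmult_lt_0_compat; [lra|apply pow_lt; lra]).
        apply Rmult_le_reg_l with beta; [lra|].
        replace (beta * (s / beta * (ln (d i) + ln (d j))))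
          with (s * (ln (d i) + ln (d j))) by (field; lra).
        apply Rle_trans with (s * (- (2 * q * (T * q ^ k)))); [|apply Rmult_le_compat_l; lra].
        pose proof (Rmult_le_compat_r _ _ _ (Rlt_le _ _ HTq) Hexp); lra.
      * rewrite !gauge_pow_pos_eq by assumption; unfold M.
        rewrite ln_mult, ln_exp by (try apply exp_pos; lra).
        replace (beta * (ln 2 + s / beta * (ln (d i) + ln (d j))))
          with (beta * ln 2 + (s * ln (d i) + s * ln (d j))) by (field; lra).
        rewrite !exp_plus, Rmult_assoc; apply Rmult_le_compat_r.
        { left; apply Rmult_lt_0_compat; apply exp_pos. }
        (* This is 2^beta <= 2, which holds since [beta <= 1]. *)
        rewrite <- (exp_ln 2) at 2 by lra; apply exp_le_compat.
        pose proof ln_lt_2; nra.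
  - intros e He; destruct (Hcov e He) as (i & j & Hij).
    exists (to_nat (i, j)); unfold D; now rewrite cancel_of_to.
  - intros N.
    apply (cantor_product_sum_le (fun i => 2 * gauge_pow s (d i)) (fun i => gauge_pow s (d i)));
      intros n; auto using gauge_pow_nonneg.
    + pose proof (gauge_pow_nonneg s (d n)); lra.
    + rewrite (sum_eq _ (fun i => gauge_pow s (d i) * 2)) by (intros; ring).
      rewrite <- scal_sum; apply Rmult_le_compat_l; [lra|apply Htau].
Qed.

(** * Choice of parameters and conclusion *)

(** Follows from exp(x) > x. Every larger [T] also serves, so several thresholds can be met by
    adding them. *)
Lemma exp_neg_small (c eps : R) : 0 < c -> 0 < eps ->
  forall T, / (c * eps) <= T -> exp (- (c * T)) < eps.
Proof.
  intros Hc Heps T HT.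
  assert (0 < / (c * eps)) by (apply Rinv_0_lt_compat, Rmult_lt_0_compat; lra).
  rewrite exp_Ropp, <- (Rinv_inv eps).
  apply Rinv_lt_contravar; [apply Rmult_lt_0_compat; [apply Rinv_0_lt_compat; lra|apply exp_pos]|].
  apply Rle_lt_trans with (c * T).
  - apply Rmult_le_compat_l with (r := c) in HT; [|lra].
    replace (c * / (c * eps)) with (/ eps) in HT by (field; lra); assumption.
  - pose proof (exp_ineq1_le (c * T)); lra.
Qed.

Theorem theorem4p6 (beta : R) (E : R2 -> Prop) :
  0 < beta <= 1 ->
  F_hg_set gauge_log (gauge_pow beta) E ->
  exists d, hausdorff_dim E d /\ beta / 2 <= d.
Proof.
  intros Hbeta (L & HL & Hpos & deltaE & HdeltaE & Hline).
  apply hausdorff_dim_ge; intros s Hs Hnull.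
  destruct (Rle_lt_dec (beta / 2) s) as [|Hlt]; [assumption|exfalso].
  apply Hpos; intros delta Hdelta eps Heps.
  (* Here s < beta/2 makes [gam] positive, and 2 s q = beta (1 - 2 gam)(1 + gam) <= beta (1 -
     gam). *)
  pose (gam := 1 / 2 - s / beta); pose (q := 1 + gam).
  assert (Hsb : 0 <= s / beta < 1 / 2).
  { split; [apply Rmult_le_pos; [lra|left; apply Rinv_0_lt_compat; lra]|].
    apply Rmult_lt_reg_r with beta; [lra|]; unfold Rdiv at 1.
    rewrite Rmult_assoc, Rinv_l; lra. }
  assert (Hgam : 0 < gam <= 1 / 2) by (unfold gam; lra).
  assert (Hexp : 2 * s * q <= beta * (1 - gam)).
  { replace (2 * s) with (beta * (1 - 2 * gam)) by (unfold gam; field; lra).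
    rewrite Rmult_assoc; apply Rmult_le_compat_l; [lra|unfold q; nra]. }
  (* [T1] bounds the series over the scales by 1, [T2] makes the covering sets on a line smaller
     than [deltaE / 2], and [T3] makes the direction sets smaller than [delta]. *)
  pose (T1 := / gam * (1 + q / (q - 1))); pose (T2 := / (gam * (deltaE / 2)));
    pose (T3 := / ((1 - gam) * (delta / 2))); pose (T := T1 + T2 + T3).
  assert (Hig : 0 < / gam) by (apply Rinv_0_lt_compat; lra).
  assert (Hqq : 0 < q / (q - 1)) by (unfold q; apply Rdiv_lt_0_compat; lra).
  assert (HT1 : 0 < T1) by (unfold T1; apply Rmult_lt_0_compat; lra).
  assert (HT2 : 0 < T2) by (apply Rinv_0_lt_compat, Rmult_lt_0_compat; lra).
  assert (HT3 : 0 < T3) by (apply Rinv_0_lt_compat, Rmult_lt_0_compat; lra).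
  assert (HgT : 1 + q / (q - 1) <= gam * T).
  { apply Rle_trans with (gam * T1); [|apply Rmult_le_compat_l; unfold T; lra].
    unfold T1; rewrite <- Rmult_assoc, Rinv_r; lra. }
  assert (HdE : exp (- (gam * T)) < deltaE / 2)
    by (apply exp_neg_small; unfold T, T2 in *; lra).
  assert (Hd : 2 * exp (- ((1 - gam) * T)) < delta).
  { assert (exp (- ((1 - gam) * T)) < delta / 2)
      by (apply exp_neg_small; unfold T, T3 in *; lra); lra. }
  (* Gives 2 tau^2 <= eps/2. *)
  pose (tau := Rmin 1 (eps / 4)).
  assert (Htau : 0 < tau <= 1 /\ tau <= eps / 4).
  { unfold tau; split; [split; [apply Rmin_pos; lra|apply Rmin_l]|apply Rmin_r]. }
  (* A diameter below exp(-T) is zero or belongs to some scale. *)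
  destruct (Hnull (exp (- T)) (exp_pos _) tau) as (v & (A & d & HA & Hcov & Hsum) & Hv); [lra|].
  destruct (directions_cover beta s gam q T delta tau L A d) as [r [Hr Hle]];
    try (unfold T, q in *; lra); try assumption.
  - intros i; apply HA.
  - intros N; apply Rle_trans with v; [|lra].
    apply sum_incr; [assumption|]; intros n; apply gauge_pow_nonneg.
  - intros e He.
    (* If [e] were not a chord direction, pieces of one scale would be close together along the
       segment in direction [e], and its content would be at most 1, against the lower bound
       [c > 1]. *)
    apply NNPP; intros Hno.
    destruct (Hline e He) as (a & l & Hcontent).
    destruct (Hcontent (deltaE / 2)) as (c & Hc & Hmin); [lra|].
    destruct (line_log_content_small a e l (fun x => segment a e l x /\ E x) A d T q gam
      (deltaE / 2)) as [w [Hw Hw1]]; auto; try (unfold T, q in *; lra).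
    + now intros x [Hx _].
    + intros x [_ Hx]; now apply Hcov.
    + intros i j k x y t Hx Hy Hi Hj Exy.
      apply Rnot_lt_le; intros Ht; apply Hno; exists i, j; split; [assumption|].
      now exists k, x, y, t.
    + specialize (Hmin w Hw).
      assert (/ (gam * T) * (q / (q - 1)) <= 1); [|lra].
      apply Rmult_le_reg_l with (gam * T); [lra|].
      rewrite <- Rmult_assoc, Rinv_r; lra.
  - exists r; split; [assumption|nra].
Qed.
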